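(* Under the setting below, suppose the index sets of Algorithm BC satisfy the randomized sampling requirement. Then almost surely: (i) $\sum_k\|\bm x^k-\bm z^k\|^2<\infty$ (in particular $\|\bm x^k-\bm z^k\|\to0$); (ii) $\Phi(\bm z^k)\to\Phi_\star$, where $\Phi_\star:=\lim_k\Phi^{\mathrm{FB}}_\Gamma(\bm x^k)$ (a finite limit with $\Phi_\star\ge\min\Phi$); (iii) $(\bm x^k)$ and $(\bm z^k)$ have the same cluster points, every such cluster point $\bm x^\star$ satisfies $0\in\hat\partial\Phi(\bm x^\star)$, and $\Phi(\bm x^\star)=\Phi^{\mathrm{FB}}_\Gamma(\bm x^\star)=\Phi_\star$.
   Context: Setting: $N\ge1$, $n=\sum_{i=1}^N n_i$, $\bm x=(x_1,\dots,x_N)$ with $x_i\in\mathbb R^{n_i}$; $\Phi=F+G$ with $F(\bm x)=\frac1N\sum_i f_i(x_i)$, each $f_i:\mathbb R^{n_i}\to\mathbb R$ differentiable with $L_{f_i}$-Lipschitz gradient, $G:\mathbb R^n\to\mathbb R\cup\{+\infty\}$ proper lsc, $\arg\min\Phi\ne\emptyset$. $\gamma_i\in(0,N/L_{f_i})$, $\Gamma=\operatorname{blockdiag}(\gamma_1I_{n_1},\dots,\gamma_NI_{n_N})$, $\|x\|_V^2=\langle x,Vx\rangle$, $\operatorname{prox}_G^{V}(u)=\arg\min_w\{G(w)+\frac12\|w-u\|_V^2\}$, $\mathbf T(\bm x)=\operatorname{prox}_G^{\Gamma^{-1}}(\bm x-\Gamma\nabla F(\bm x))$. Forward-backward envelope: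 $\Phi^{\mathrm{FB}}_\Gamma(\bm x):=\inf_{\bm w}\{F(\bm x)+\langle\nabla F(\bm x),\bm w-\bm x\rangle+G(\bm w)+\frac12\|\bm w-\bm x\|^2_{\Gamma^{-1}}\}$. Algorithm BC: given $\bm x^0\in\mathbb R^n$, for $k=0,1,\dots$: pick $\bm z^k\in\mathbf T(\bm x^k)$; select $I^{k+1}\subseteq[N]$; set $x_i^{k+1}=z_i^k$ for $i\in I^{k+1}$ and $x_i^{k+1}=x_i^k$ otherwise. Randomized sampling requirement: there exist $p_1,\dots,p_N>0$ such that at every iteration, conditionally on the past, $\mathbb P(i\in I^{k+1})\ge p_i$ for every $i\in[N]$ (several indices may be selected at once; the $p_i$ need not sum to one). $\hat\partial$ denotes the regular (Fréchet) subdifferential. *)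

(* Defs.v *)
From HB Require Import structures.
From mathcomp Require Import all_boot all_order all_algebra.
From mathcomp Require Import all_classical all_reals all_analysis.
Set Implicit Arguments. Unset Strict Implicit. Unset Printing Implicit Defensive.
Import Order.TTheory GRing.Theory Num.Theory.
Import numFieldNormedType.Exports.
Local Open Scope classical_set_scope.
Local Open Scope ring_scope.

Section BlockDefs.
Variable R : realType.

Definition sqn m (v : 'rV[R]_m) : R := \sum_(j < m) (v 0 j) ^+ 2.
Definition dotv m (u v : 'rV[R]_m) : R := \sum_(j < m) u 0 j * v 0 j.

Definition grad m (g : 'rV[R]_m -> R) (u : 'rV[R]_m) : 'rV[R]_m :=
  \row_(j < m) ('d g u (delta_mx 0 j : 'rV[R]_m)).

Variable N : nat.
Variable ns : 'I_N -> nat.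

(* x = (x_1, ..., x_N), x_i in R^{n_i}; R^n with n = sum n_i *)
Definition vecB := forall i : 'I_N, 'rV[R]_(ns i).

Definition dotB (x y : vecB) : R := \sum_(i < N) dotv (x i) (y i).
Definition dist2B (x y : vecB) : R := \sum_(i < N) sqn (x i - y i).
Definition distB (x y : vecB) : R := Num.sqrt (dist2B x y).
Definition wdist2B (gamma : 'I_N -> R) (x y : vecB) : R :=
  \sum_(i < N) (gamma i)^-1 * sqn (x i - y i).

Variable f : forall i : 'I_N, 'rV[R]_(ns i) -> R.
Variable G : vecB -> \bar R.
Variable gamma : 'I_N -> R.

Definition FF (x : vecB) : R := N%:R^-1 * \sum_(i < N) @f i (x i).
Definition gradFF (x : vecB) : vecB := fun i => N%:R^-1 *: grad (@f i) (x i).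
Definition Phi (x : vecB) : \bar R := (FF x)%:E + G x.

Definition FBmodel (x w : vecB) : \bar R :=
  (FF x + dotB (gradFF x) (fun i => w i - x i) + 2^-1 * wdist2B gamma w x)%:E
  + G w.

(* T(x) = prox_G^{Gamma^{-1}}(x - Gamma grad F(x)) (set-valued) *)
Definition Tmap (x : vecB) : set vecB :=
  [set w | forall v, (FBmodel x w <= FBmodel x v)%E].

Definition PhiFB (x : vecB) : \bar R := ereal_inf (range (FBmodel x)).

End BlockDefs.

Section Misc.
Variable R : realType.
Variable N : nat.
Variable ns : 'I_N -> nat.

Definition proper_fun (G : vecB R ns -> \bar R) : Prop :=
  (forall x, G x != -oo%E) /\ (exists x, G x != +oo%E).

Definition lsc_fun (G : vecB R ns -> \bar R) : Prop :=
  forall x0 (a : R), (a%:E < G x0)%E ->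
    exists2 d : R, 0 < d & forall y, distB y x0 < d -> (a%:E < G y)%E.

Definition frechet_subgrad (H : vecB R ns -> \bar R) (y v : vecB R ns) : Prop :=
  H y \is a fin_num /\
  forall e : R, 0 < e -> exists2 d : R, 0 < d & forall w, distB w y < d ->
    (H y + (dotB v (fun i => w i - y i) - e * distB w y)%:E <= H w)%E.

Definition zeroB : vecB R ns := fun i => 0.

Definition cluster_point (u : nat -> vecB R ns) (y : vecB R ns) : Prop :=
  forall e : R, 0 < e -> forall k0 : nat, exists2 k, (k0 <= k)%N & distB (u k) y < e.
End Misc.

Section Prob.
Variable R : realType.
Variables (d : measure_display) (T : measurableType d).

Definition filtration (F : nat -> set (set T)) : Prop :=
  (forall k, sigma_algebra setT (F k)) /\
  (forall k A, F k A -> measurable A) /\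
  (forall k A, F k A -> F k.+1 A).

Definition vec_meas N (ns : 'I_N -> nat) (S : set (set T)) (X : T -> vecB R ns) :=
  forall i j (B : set R), measurable B -> S ((fun w => X w i 0 j) @^-1` B).

Definition set_meas N (S : set (set T)) (X : T -> {set 'I_N}) :=
  forall i, S [set w | i \in X w].
End Prob.

(* Main.v *)
(* Write a_i(x, w) for the i-th squared block |w_i - x_i|^2.  By the quadratic bounds on each f_i,
   replacing the blocks in J of x by those of z in T(x) lowers the forward-backward envelope by at
   least sum_(i in J) c_i a_i(x, z) with c_i = (1/gamma_i - L_i/N)/2 > 0.  As the envelope is
   bounded below by min Phi, sum_k sum_(i in I^(k+1)) c_i a_i(x^k, z^k) is bounded by a
   deterministic constant; taking expectations, the sampling condition gives
   sum_k E a_i(x^k, z^k) < oo, so sum_k |x^k - z^k|^2 < oo almost surely.  On that event Phi(z^k)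
   is squeezed onto the limit of the envelope, and at a cluster point y semicontinuity
   yields Phi(y) <= Phi_star <= PhiFB(y) <= Phi(y), so y minimises its own model.  *)
Require Import Defs.
From HB Require Import structures.
From mathcomp Require Import all_boot all_order all_algebra.
From mathcomp Require Import all_classical all_reals all_analysis.
From mathcomp Require Import measurable_realfun ring lra.
Import Order.TTheory GRing.Theory Num.Theory.
Import numFieldNormedType.Exports.
Local Open Scope classical_set_scope.
Local Open Scope ring_scope.

(** * Quadratic bounds for functions with Lipschitz gradient *)

Section Smooth.
Set Implicit Arguments. Unset Strict Implicit.
Variables (R : realType) (m : nat).
Implicit Types (u v w : 'rV[R]_m) (a t L : R) (f : 'rV[R]_m -> R).

Lemma sqn_ge0 u : 0 <= sqn u.
Proof. by apply: sumr_ge0 => j _; exact: sqr_ge0. Qed.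

Lemma sqnZ a u : sqn (a *: u) = a ^+ 2 * sqn u.
Proof. by rewrite /sqn mulr_sumr; apply: eq_bigr => j _; rewrite mxE exprMn. Qed.

Lemma sqnBC u v : sqn (u - v) = sqn (v - u).
Proof. by apply: eq_bigr => j _; rewrite !mxE -sqrrN opprB. Qed.

Lemma dotvBr u v w : dotv u (v - w) = dotv u v - dotv u w.
Proof. by rewrite /dotv -sumrB; apply: eq_bigr => j _; rewrite !mxE mulrBr. Qed.

Lemma dotvBl u v w : dotv (u - v) w = dotv u w - dotv v w.
Proof. by rewrite /dotv -sumrB; apply: eq_bigr => j _; rewrite !mxE mulrBl. Qed.

Lemma dotvBC u v w : dotv u (v - w) = - dotv u (w - v).
Proof. by rewrite !dotvBr opprB. Qed.

(** Isolates the differences [a - b], which the Lipschitz bound controls when [a] and [b] are the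
    gradients at [u] and [w]. *)
Lemma dotv_rebase (a b : 'rV[R]_m) u v w :
  dotv a (v - u) = dotv (a - b) (v - w) + dotv (a - b) (w - u)
                   + dotv b (v - w) - dotv b (u - w).
Proof. by rewrite !dotvBl !dotvBr; ring. Qed.

Lemma dotvZl a u v : dotv (a *: u) v = a * dotv u v.
Proof. by rewrite /dotv mulr_sumr; apply: eq_bigr => j _; rewrite mxE mulrA. Qed.

Lemma sqn_eq0 u : sqn u = 0 -> u = 0.
Proof.
move=> /eqP; rewrite psumr_eq0 => [/allP u0|j _]; last exact: sqr_ge0.
apply/rowP => j; rewrite mxE; apply/eqP; rewrite -sqrf_eq0.
by apply: u0; rewrite mem_index_enum.
Qed.

Lemma dotv_le u v : dotv u v <= Num.sqrt (sqn u) * Num.sqrt (sqn v).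
Proof.
set a := Num.sqrt (sqn u); set b := Num.sqrt (sqn v).
have a2 : a ^+ 2 = sqn u by rewrite sqr_sqrtr ?sqn_ge0.
have b2 : b ^+ 2 = sqn v by rewrite sqr_sqrtr ?sqn_ge0.
have [/eqP ab0|ab0] := eqVneq (a * b) 0.
  have [u0|v0] : u = 0 \/ v = 0.
    move: ab0; rewrite mulf_eq0 => /orP[]/eqP e; [left|right]; apply: sqn_eq0.
      by rewrite -a2 e expr0n.
    by rewrite -b2 e expr0n.
  - by rewrite u0 /dotv big1 ?mulr_ge0 ?sqrtr_ge0// => j _; rewrite mxE mul0r.
  - by rewrite v0 /dotv big1 ?mulr_ge0 ?sqrtr_ge0// => j _; rewrite mxE mulr0.
have ab : 0 < a * b by rewrite lt_def ab0 mulr_ge0 ?sqrtr_ge0.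
(* Cauchy-Schwarz: [2ab(ab - <u,v>)] is the sum of the squares [(b u_j - a v_j)^2]. *)
have : 0 <= 2 * (a * b) * (a * b - dotv u v).
  suff -> : 2 * (a * b) * (a * b - dotv u v)
          = \sum_(j < m) (b * u 0 j - a * v 0 j) ^+ 2.
    by apply: sumr_ge0 => j _; exact: sqr_ge0.
  transitivity (b ^+ 2 * sqn u - 2 * (a * b) * dotv u v + a ^+ 2 * sqn v).
    by rewrite -a2 -b2; ring.
  rewrite /sqn /dotv !mulr_sumr -sumrB -big_split/=.
  by apply: eq_bigr => j _; ring.
by rewrite pmulr_rge0 ?subr_ge0// mulr_gt0.
Qed.

Lemma diff_grad f u v : differentiable f u -> 'd f u v = dotv (grad f u) v.
Proof.
move=> df; rewrite {1}(row_sum_delta v) linear_sum.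
by apply: eq_bigr => j _; rewrite linearZ/= !mxE mulrC.
Qed.

Lemma is_derive_line f u v t : differentiable f (u + t *: v) ->
  is_derive t 1 (fun s => f (u + s *: v)) (dotv (grad f (u + t *: v)) v).
Proof.
move=> df; rewrite -diff_grad// -deriveE//.
(* Along the line, the difference quotient at [t] is that of [f] at [u + t v] in direction [v]. *)
have E : (fun h => h^-1 *: (((fun s => f (u + s *: v)) \o shift t) (h *: 1)
            - f (u + t *: v)))
       = (fun h => h^-1 *: ((f \o shift (u + t *: v)) (h *: v) - f (u + t *: v))).
  apply/funext => h /=; congr (_ *: (f _ - _)).
  by rewrite /shift /= [h *: 1]mulr1 scalerDl addrCA addrC -addrA addrC.
by apply: DeriveDef; [rewrite /derivable E; exact: diff_derivable|rewrite /derive E].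
Qed.

(** Descent lemma without integration: [psi], which is [f] on the segment minus the linear and
    quadratic terms of its majorant, has derivative at most 0 on (0,1) by Cauchy-Schwarz and the
    Lipschitz bound. The claim is [psi 1 <= psi 0]. *)
Lemma smooth_le f L : 0 <= L -> (forall u, differentiable f u) ->
  (forall u v, Num.sqrt (sqn (grad f u - grad f v)) <= L * Num.sqrt (sqn (u - v))) ->
  forall u v, f v <= f u + dotv (grad f u) (v - u) + L / 2 * sqn (v - u).
Proof.
move=> L0 df lip u v; set w := v - u.
pose psi t := f (u + t *: w) - (t * dotv (grad f u) w + L / 2 * sqn w * t ^+ 2).
have dpsi t : is_derive t 1 psi (dotv (grad f (u + t *: w)) w
     - (dotv (grad f u) w + L * sqn w * t)).
  have ? := @is_derive_line f u w t (df _).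
  by apply: is_derive_eq; rewrite /GRing.scale/=; congr (_ - _); field.
have : psi 1 <= psi 0.
  apply: (@ler0_derive1_le_cc _ psi 0 1) => //.
  - move=> t; rewrite in_itv/= => /andP[t0 t1].
    rewrite derive1E (@derive_val _ _ _ _ _ _ _ (dpsi t)) subr_le0 -lerBlDl -dotvBl.
    apply: (le_trans (dotv_le _ _)).
    have -> : L * sqn w * t
            = L * Num.sqrt (sqn (u + t *: w - u)) * Num.sqrt (sqn w).
      rewrite addrC addKr sqnZ sqrtrM ?sqr_ge0// sqrtr_sqr gtr0_norm//.
      by rewrite -[in LHS](@sqr_sqrtr _ (sqn w)) ?sqn_ge0//; ring.
    by rewrite ler_wpM2r ?sqrtr_ge0.
  - apply: derivable_within_continuous => t _. exact: ex_derive.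
  - by rewrite in_itv/= lexx ler01.
  - by rewrite in_itv/= lexx ler01.
rewrite /psi scale1r scale0r addr0 mul0r expr0n/= mulr0 addr0 subr0 mul1r expr1n mulr1.
have -> : u + w = v by rewrite addrC subrK.
by lra.
Qed.

(** This is the upper bound for [- f], whose gradient has the same Lipschitz constant. *)
Lemma smooth_ge f L : 0 <= L -> (forall u, differentiable f u) ->
  (forall u v, Num.sqrt (sqn (grad f u - grad f v)) <= L * Num.sqrt (sqn (u - v))) ->
  forall u v, f u + dotv (grad f u) (v - u) - L / 2 * sqn (v - u) <= f v.
Proof.
move=> L0 df lip u v.
have gradN w : grad (- f) w = - grad f w.
  by apply/rowP => j; rewrite !mxE diffN.
have dfN w : differentiable (- f) w by exact: differentiableN.
have lipN w1 w2 : Num.sqrt (sqn (grad (- f) w1 - grad (- f) w2))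
    <= L * Num.sqrt (sqn (w1 - w2)).
  by rewrite !gradN opprK addrC sqnBC (le_trans (lip _ _))// sqnBC.
have := @smooth_le (- f) L L0 dfN lipN u v.
rewrite gradN -{1}[- grad f u]add0r dotvBl.
have -> : dotv 0 (v - u) = 0 by rewrite /dotv big1// => j _; rewrite mxE mul0r.
have fN w : (- f) w = - f w by [].
by rewrite !fN; lra.
Qed.
End Smooth.

(** * The block-separable quadratic part of the forward-backward model *)

Section BlockModel.
Set Implicit Arguments. Unset Strict Implicit.
Variables (R : realType) (N : nat) (ns : 'I_N -> nat).
Variables (f : forall i : 'I_N, 'rV[R]_(ns i) -> R) (L gamma : 'I_N -> R).
Hypothesis N_gt0 : (0 < N)%N.
Hypothesis df : forall i (u : 'rV[R]_(ns i)), differentiable (@f i) u.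
Hypothesis L_ge0 : forall i, 0 <= L i.
Hypothesis lip : forall i (u v : 'rV[R]_(ns i)),
  Num.sqrt (sqn (grad (@f i) u - grad (@f i) v)) <= L i * Num.sqrt (sqn (u - v)).
Hypothesis gammaL : forall i, 0 < gamma i /\ gamma i * L i < N%:R.
Implicit Types (i : 'I_N) (x y z w : vecB R ns).

(** The real-valued part of [FBmodel]; splitting off the extended-real [G] leaves arithmetic in
    [R]. *)
Definition fb_quad x w : R :=
  FF f x + dotB (gradFF f x) (fun i => w i - x i) + 2^-1 * wdist2B gamma w x.

Definition fb_block i (u v : 'rV[R]_(ns i)) : R :=
  N%:R^-1 * f u + dotv (N%:R^-1 *: grad (@f i) u) (v - u)
  + 2^-1 * ((gamma i)^-1 * sqn (v - u)).

Lemma fb_blockE i (u v : 'rV[R]_(ns i)) : fb_block u v =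
  N%:R^-1 * (f u + dotv (grad (@f i) u) (v - u))
  + 2^-1 * ((gamma i)^-1 * sqn (v - u)).
Proof. by rewrite /fb_block dotvZl mulrDr. Qed.

(** The block model based at [u] exceeds [f_i / N] at [v] by between [curv_min] and [curv_max] times
    [|v - u|^2], as [f_i / N] differs from its linearisation by at most [L_i / (2N) |v - u|^2]. *)
Definition curv_min i : R := 2^-1 * ((gamma i)^-1 - L i / N%:R).
Definition curv_max i : R := 2^-1 * ((gamma i)^-1 + L i / N%:R).

Lemma fb_quadE x w : fb_quad x w = \sum_(i < N) fb_block (x i) (w i).
Proof.
by rewrite /fb_quad /FF /dotB /wdist2B !mulr_sumr -!big_split.
Qed.

Lemma FFE x : FF f x = \sum_(i < N) N%:R^-1 * f (x i).
Proof. by rewrite /FF mulr_sumr. Qed.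

Let N0 : 0 < N%:R^-1 :> R. Proof. by rewrite invr_gt0 ltr0n. Qed.

Lemma curv_min_gt0 i : 0 < curv_min i.
Proof.
have [g0 gL] := gammaL i; rewrite mulr_gt0 ?invr_gt0// subr_gt0.
by rewrite ltr_pdivrMr ?ltr0n// ltr_pdivlMl.
Qed.

Lemma curv_max_ge0 i : 0 <= curv_max i.
Proof.
have [g0 gL] := gammaL i.
by rewrite mulr_ge0 ?invr_ge0// addr_ge0 ?invr_ge0 ?(ltW g0)// divr_ge0.
Qed.

Lemma fb_block_ge i (u v : 'rV[R]_(ns i)) :
  N%:R^-1 * f v + curv_min i * sqn (v - u) <= fb_block u v.
Proof.
have := @smooth_le _ _ (@f i) (L i) (L_ge0 i) (@df i) (@lip i) u v.
move=> /(ler_wpM2l (ltW N0)); rewrite fb_blockE /curv_min; lra.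
Qed.

Lemma fb_block_le i (u v : 'rV[R]_(ns i)) :
  fb_block u v <= N%:R^-1 * f v + curv_max i * sqn (v - u).
Proof.
have := @smooth_ge _ _ (@f i) (L i) (L_ge0 i) (@df i) (@lip i) u v.
move=> /(ler_wpM2l (ltW N0)); rewrite fb_blockE /curv_max; lra.
Qed.

Lemma fb_block_diag i (u : 'rV[R]_(ns i)) : fb_block u u = N%:R^-1 * f u.
Proof.
rewrite /fb_block subrr /dotv /sqn !big1 ?mulr0 ?addr0//.
- by move=> j _; rewrite mxE expr0n.
- by move=> j _; rewrite [X in _ * X]mxE mulr0.
Qed.

(** Upper semicontinuity of the model in its base point, with an explicit modulus. The constant may
    depend on [y] and [v] but not on [u]. *)
Lemma fb_block_usc i (y v : 'rV[R]_(ns i)) : exists2 C, 0 <= C &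
  forall u, fb_block u v <= fb_block y v
    + C * (Num.sqrt (sqn (u - y)) + sqn (u - y)).
Proof.
have [g0 _] := gammaL i; have gV0 : 0 < (gamma i)^-1 by rewrite invr_gt0.
set b := Num.sqrt (sqn (v - y)); have b0 : 0 <= b by exact: sqrtr_ge0.
have L0 := L_ge0 i.
exists (N%:R^-1 * (2 * L i + L i * b) + (gamma i)^-1 * (b + 1)).
  by rewrite addr_ge0// mulr_ge0 ?(ltW N0) ?(ltW gV0)// addr_ge0// mulr_ge0.
move=> u; set D := Num.sqrt (sqn (u - y)).
have D0 : 0 <= D by exact: sqrtr_ge0.
have D2 : sqn (u - y) = D ^+ 2 by rewrite sqr_sqrtr ?sqn_ge0.
have h1 := @smooth_le _ _ (@f i) (L i) (L_ge0 i) (@df i) (@lip i) y u.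
have gu := @lip i u y.
rewrite !fb_blockE.
move: (grad (@f i) u) (grad (@f i) y) (f u) (f y) h1 gu => a c fu fy h1 gu.
have h2 : dotv (a - c) (v - y) <= L i * D * b.
  by rewrite (le_trans (dotv_le _ _))// ler_wpM2r ?sqrtr_ge0.
have h3 : dotv (a - c) (y - u) <= L i * D * D.
  by rewrite (le_trans (dotv_le _ _))// [sqn (y - u)]sqnBC ler_wpM2r ?sqrtr_ge0.
have h4 : dotv (v - y) (y - u) <= b * D.
  by rewrite (le_trans (dotv_le _ _))// [sqn (y - u)]sqnBC.
have e1 : sqn (v - u) = sqn (v - y) + 2 * dotv (v - y) (y - u) + sqn (u - y).
  rewrite /sqn /dotv mulr_sumr -!big_split/=.
  by apply: eq_bigr => j _; rewrite !mxE; ring.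
have e2 := dotv_rebase a c u v y.
have H1 : fu + dotv a (v - u) <= fy + dotv c (v - y)
    + (2 * L i + L i * b) * (D + D ^+ 2).
  have ? : 0 <= L i * b * D ^+ 2 by rewrite !mulr_ge0.
  (* The term [dotv c (u - y)] of the descent bound [h1] cancels against the last term of [e2]; only
     multiples of [D] and [D^2] remain. *)
  have ? : 0 <= L i * D by rewrite mulr_ge0.
  have ? : 0 <= L i * D ^+ 2 by rewrite mulr_ge0 ?sqr_ge0.
  rewrite e2; move: h1 h2 h3; rewrite D2; lra.
have H2 : 2^-1 * sqn (v - u) <= 2^-1 * sqn (v - y) + (b + 1) * (D + D ^+ 2).
  have ? : 0 <= b * D ^+ 2 by rewrite !mulr_ge0.
  have ? := sqr_ge0 D.
  rewrite e1 D2; lra.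
move: (ler_wpM2l (ltW N0) H1) (ler_wpM2l (ltW gV0) H2).
rewrite D2; lra.
Qed.

Lemma block_lsc i (y : 'rV[R]_(ns i)) : exists2 C, 0 <= C &
  forall u, N%:R^-1 * f y
    <= N%:R^-1 * f u + C * (Num.sqrt (sqn (u - y)) + sqn (u - y)).
Proof.
have L0 := L_ge0 i.
set b := Num.sqrt (sqn (grad (@f i) y)); have b0 : 0 <= b by exact: sqrtr_ge0.
exists (N%:R^-1 * (b + L i)); first by rewrite mulr_ge0 ?addr_ge0 ?(ltW N0).
move=> u; set D := Num.sqrt (sqn (u - y)).
have D0 : 0 <= D by exact: sqrtr_ge0.
have D2 : sqn (u - y) = D ^+ 2 by rewrite sqr_sqrtr ?sqn_ge0.
have h1 := @smooth_ge _ _ (@f i) (L i) (L_ge0 i) (@df i) (@lip i) y u.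
move: (grad (@f i) y) (f u) (f y) @b b0 h1 => c fu fy b b0 h1.
have h2 : - dotv c (u - y) <= b * D.
  by rewrite -dotvBC (le_trans (dotv_le _ _))// [sqn (y - u)]sqnBC.
have H : fy <= fu + (b + L i) * (D + D ^+ 2).
  have ? : 0 <= L i * D by rewrite mulr_ge0.
  have ? : 0 <= L i * D ^+ 2 by rewrite mulr_ge0 ?sqr_ge0.
  have ? : 0 <= b * D ^+ 2 by rewrite !mulr_ge0.
  move: h1; rewrite D2; lra.
by move: (ler_wpM2l (ltW N0) H); rewrite D2; lra.
Qed.

Lemma dist2B_ge0 x y : 0 <= dist2B x y.
Proof. by apply: sumr_ge0 => i _; exact: sqn_ge0. Qed.

Lemma sqn_le_dist2B x y i : sqn (x i - y i) <= dist2B x y.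
Proof.
by rewrite /dist2B (bigD1 i)//= lerDl; apply: sumr_ge0 => j _; exact: sqn_ge0.
Qed.

Lemma small_modulus (C e : R) : 0 <= C -> 0 < e ->
  exists2 r : R, 0 < r & forall x y, distB x y < r ->
    C * (distB x y + dist2B x y) < e.
Proof.
(* Below radius 1 the square is at most the distance, so the modulus is at most [2C] times the
   distance. *)
move=> C0 e0; exists (Num.min 1 (e / (2 * (C + 1)))).
  by rewrite lt_min ltr01 divr_gt0// mulr_gt0// ltr_wpDl.
move=> x y; rewrite lt_min ltr_pdivlMr ?mulr_gt0 ?ltr_wpDl// => /andP[D1 De].
have D0 : 0 <= distB x y by exact: sqrtr_ge0.
rewrite -[dist2B x y]sqr_sqrtr ?dist2B_ge0// -/(distB x y).
have : distB x y * distB x y <= distB x y by rewrite ler_piMl// ltW.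
move=> /(ler_wpM2l C0); lra.
Qed.

Lemma sum_modulus (A B : forall i, 'rV[R]_(ns i) -> R) y :
  (forall i, exists2 C, 0 <= C & forall u,
    A i u <= B i u + C * (Num.sqrt (sqn (u - y i)) + sqn (u - y i))) ->
  forall e, 0 < e -> exists2 r : R, 0 < r & forall x, distB x y < r ->
    \sum_(i < N) A i (x i) < \sum_(i < N) B i (x i) + e.
Proof.
move=> /(_ _)/cid2 H; pose C i := s2val (H i).
have C0 : 0 <= \sum_(i < N) C i by apply: sumr_ge0 => i _; exact: (s2valP (H i)).
move=> e e0; have [r r0 rP] := small_modulus C0 e0.
exists r => // x /rP Ce.
have S : \sum_(i < N) A i (x i)
    <= \sum_(i < N) B i (x i) + (\sum_(i < N) C i) * (distB x y + dist2B x y).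
  rewrite mulr_suml -big_split/=; apply: ler_sum => i _.
  apply: (le_trans (s2valP' (H i) _)); rewrite lerD2l ler_wpM2l ?(s2valP (H i))//.
  by rewrite lerD ?sqn_le_dist2B// ler_wsqrtr// sqn_le_dist2B.
by apply: (le_lt_trans S); rewrite ltrD2l.
Qed.

Lemma fb_quad_usc y v e : 0 < e -> exists2 r : R, 0 < r &
  forall x, distB x y < r -> fb_quad x v < fb_quad y v + e.
Proof.
move=> e0; have [r r0 rP] := @sum_modulus (fun i u => fb_block u (v i))
  (fun i _ => fb_block (y i) (v i)) y (fun i => fb_block_usc (y i) (v i)) e e0.
by exists r => // x /rP; rewrite !fb_quadE.
Qed.

Lemma FF_lsc y e : 0 < e -> exists2 r : R, 0 < r &
  forall x, distB x y < r -> FF f y < FF f x + e.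
Proof.
move=> e0; have [r r0 rP] := @sum_modulus (fun i _ => N%:R^-1 * f (y i))
  (fun i u => N%:R^-1 * f u) y (fun i => block_lsc (y i)) e e0.
by exists r => // x /rP; rewrite !FFE.
Qed.

Lemma fb_quad_ge x w :
  FF f w + \sum_(i < N) curv_min i * sqn (w i - x i) <= fb_quad x w.
Proof.
by rewrite fb_quadE FFE -big_split/=; apply: ler_sum => i _; exact: fb_block_ge.
Qed.

Lemma fb_quad_ge_FF x w : FF f w <= fb_quad x w.
Proof.
apply: le_trans (fb_quad_ge x w); rewrite lerDl; apply: sumr_ge0 => i _.
by rewrite mulr_ge0 ?sqn_ge0// ltW ?curv_min_gt0.
Qed.

Lemma fb_quad_le x w :
  fb_quad x w <= FF f w + (\sum_(i < N) curv_max i) * dist2B x w.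
Proof.
rewrite fb_quadE FFE mulr_suml -big_split/=; apply: ler_sum => i _.
apply: (le_trans (fb_block_le _ _)); rewrite lerD2l ler_wpM2l ?curv_max_ge0//.
by rewrite sqnBC sqn_le_dist2B.
Qed.

Lemma fb_quad_diag x : fb_quad x x = FF f x.
Proof. by rewrite fb_quadE FFE; apply: eq_bigr => i _; exact: fb_block_diag. Qed.

(** With the model point [z] fixed, a block in [J] is rebased at [z] itself, where its model reduces
    to [f_i / N] and drops by the curvature gap; the other blocks do not change. *)
Lemma fb_quad_update x z x' (J : {set 'I_N}) :
  (forall i, x' i = if i \in J then z i else x i) ->
  fb_quad x' z + \sum_(i in J) curv_min i * sqn (z i - x i) <= fb_quad x z.
Proof.
move=> x'E; rewrite !fb_quadE [X in _ + X]big_mkcond -big_split/=; apply: ler_sum => i _.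
rewrite x'E; case: ifPn => _; last by rewrite addr0.
by rewrite fb_block_diag fb_block_ge.
Qed.

(** * The forward-backward map, the envelope and stationarity *)

Variable G : vecB R ns -> \bar R.
Hypothesis G_proper : proper_fun G.
Hypothesis G_lsc : lsc_fun G.

Lemma FBmodelE x w : FBmodel f G gamma x w = ((fb_quad x w)%:E + G w)%E.
Proof. by []. Qed.

(** Properness provides a point with finite model value, and the model value at the minimiser [z]
    lies below it. *)
Lemma Tmap_fin_num x z : Tmap f G gamma x z -> G z \is a fin_num.
Proof.
have [GNy [v Gv]] := G_proper => /(_ v); rewrite !FBmodelE.
move: (GNy v) (GNy z) Gv.
by case: (G v) => // r _; case: (G z).
Qed.

Lemma PhiFB_Tmap x z : Tmap f G gamma x z ->
  PhiFB f G gamma x = (fb_quad x z + fine (G z))%:E.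
Proof.
move=> Tz; rewrite EFinD fineK ?(Tmap_fin_num Tz)//.
apply/eqP; rewrite eq_le; apply/andP; split.
  by apply: ereal_inf_lbound; exists z.
by apply: le_ereal_inf_tmp => _ [v _ <-]; exact: Tz.
Qed.

Lemma Phi_Tmap x z : Tmap f G gamma x z ->
  Phi f G z = (FF f z + fine (G z))%:E.
Proof. by move=> Tz; rewrite EFinD fineK// (Tmap_fin_num Tz). Qed.

Lemma PhiFB_le_Phi y : (PhiFB f G gamma y <= Phi f G y)%E.
Proof.
by apply: ereal_inf_lbound; exists y => //; rewrite FBmodelE fb_quad_diag.
Qed.

(* y minimises its own model, which exceeds Phi by at most a quadratic. *)
Lemma frechet_stationary y : Phi f G y \is a fin_num ->
  Phi f G y = PhiFB f G gamma y -> frechet_subgrad (Phi f G) y (zeroB R ns).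
Proof.
move=> fin yE; split=> // e e0.
set K := \sum_(i < N) curv_max i.
have K0 : 0 <= K by apply: sumr_ge0 => i _; exact: curv_max_ge0.
(* Within this radius [K |w - y|^2 <= e |w - y|], so the quadratic gap between model and [Phi] is
   absorbed by the Fréchet error term. *)
exists (e / (K + 1)) => [|w]; first by rewrite divr_gt0// ltr_wpDl.
rewrite ltr_pdivlMr ?ltr_wpDl// => wd.
have -> : dotB (zeroB R ns) (fun i => w i - y i) = 0.
  by rewrite /dotB big1// => i _; rewrite /dotv big1// => j _; rewrite mxE mul0r.
have : (PhiFB f G gamma y <= FBmodel f G gamma y w)%E.
  by apply: ereal_inf_lbound; exists w.
have D0 : 0 <= distB w y by exact: sqrtr_ge0.
have D2 : dist2B y w = distB w y ^+ 2.
  rewrite sqr_sqrtr ?dist2B_ge0//; apply: eq_bigr => i _; exact: sqnBC.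
have : fb_quad y w <= FF f w + e * distB w y.
  apply: (le_trans (fb_quad_le y w)); rewrite lerD2l -/K D2.
  have : distB w y * (distB w y * (K + 1)) <= distB w y * e.
    by rewrite ler_wpM2l// ltW.
  have := sqr_ge0 (distB w y); lra.
rewrite -yE FBmodelE /Phi; move: fin (G_proper.1 w); rewrite /Phi.
case: (G y) => // s _; case: (G w) => [r _|_|] // H1 H2.
- by move: H2; rewrite -!EFinD !lee_fin; lra.
- by rewrite addey// leey.
Qed.

Lemma distB_lt x y e : 0 < e -> (distB x y < e) = (dist2B x y < e ^+ 2).
Proof.
by move=> e0; rewrite -{1}(gtr0_norm e0) -sqrtr_sqr ltr_sqrt ?exprn_gt0.
Qed.

Lemma dist2B_triangle x y w : dist2B w y <= 2 * dist2B x y + 2 * dist2B x w.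
Proof.
rewrite /dist2B !mulr_sumr -big_split/=; apply: ler_sum => i _.
rewrite /sqn !mulr_sumr -big_split/=; apply: ler_sum => j _; rewrite !mxE.
(* Coordinatewise, right side minus left side is exactly this square. *)
have := sqr_ge0 (2 * x i 0 j - y i 0 j - w i 0 j); lra.
Qed.

Lemma cluster_point_close (u v : nat -> vecB R ns) y :
  (fun k => dist2B (u k) (v k)) @ \oo --> 0 ->
  cluster_point u y -> cluster_point v y.
Proof.
move=> uv cu e e0 k0; have e20 : 0 < e / 2 by rewrite divr_gt0.
have [k1 _ k1P] : \forall k \near \oo, dist2B (u k) (v k) < (e / 2) ^+ 2.
  by apply: (cvgr_lt _ uv); rewrite exprn_gt0.
have [k] := cu _ e20 (maxn k0 k1); rewrite geq_max => /andP[k0k k1k].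
rewrite distB_lt// => uy; exists k => //; rewrite distB_lt//.
have /= := k1P k k1k; have := dist2B_triangle (u k) y (v k); lra.
Qed.

(** * Descent of the envelope along one sample path *)

Section Trajectory.
Variables (x z : nat -> vecB R ns) (J : nat -> {set 'I_N}) (xs : vecB R ns).
Hypothesis xs_min : forall y, (Phi f G xs <= Phi f G y)%E.
Hypothesis zT : forall k, Tmap f G gamma (x k) (z k).
Hypothesis x_step : forall k i, x k.+1 i = if i \in J k.+1 then z k i else x k i.

(** Taking [fine] loses nothing: the envelope is attained at [z k], where [G] is finite. *)
Let V k : R := fine (PhiFB f G gamma (x k)).
Let m : R := fine (Phi f G xs).

Lemma V_eq k : V k = fb_quad (x k) (z k) + fine (G (z k)).
Proof. by rewrite /V (PhiFB_Tmap (zT k)). Qed.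

Lemma PhiFB_trajectory k : PhiFB f G gamma (x k) = (V k)%:E.
Proof. by rewrite V_eq (PhiFB_Tmap (zT k)). Qed.

Lemma min_Phi_fin : Phi f G xs = m%:E.
Proof.
rewrite fineK//; have := xs_min (z 0); rewrite (Phi_Tmap (zT 0)) /Phi.
by move: (G_proper.1 xs); case: (G xs).
Qed.

Lemma V_ge k : m <= FF f (z k) + fine (G (z k)) <= V k.
Proof.
rewrite V_eq lerD2r fb_quad_ge_FF andbT -lee_fin -(Phi_Tmap (zT k)) -min_Phi_fin.
exact: xs_min.
Qed.

(** The old point [z k] competes in the infimum defining the envelope at [x k.+1], and rebasing the
    selected blocks lowers its model value. *)
Lemma V_decrease k :
  V k.+1 + \sum_(i in J k.+1) curv_min i * sqn (z k i - x k i) <= V k.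
Proof.
rewrite [V k]V_eq; have := fb_quad_update (x_step k).
have : V k.+1 <= fb_quad (x k.+1) (z k) + fine (G (z k)).
  rewrite -lee_fin -PhiFB_trajectory EFinD fineK ?(Tmap_fin_num (zT k))//.
  by apply: ereal_inf_lbound; exists (z k).
lra.
Qed.

(** Telescoping the descent. The bound sees the path only through [x 0], so it is the same constant
    for all outcomes once the start is deterministic. *)
Lemma selected_sum_le i n :
  \sum_(k < n) (i \in J k.+1)%:R * sqn (z k i - x k i)
  <= (fine (PhiFB f G gamma (x 0)) - fine (Phi f G xs)) / curv_min i.
Proof.
rewrite -/(V 0) -/m.
have c0 := curv_min_gt0 i.
rewrite ler_pdivlMr//.
have : V n + \sum_(k < n) curv_min i * ((i \in J k.+1)%:R * sqn (z k i - x k i)) <= V 0.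
  elim: n => [|n IH]; first by rewrite big_ord0 addr0.
  apply: le_trans IH; rewrite big_ord_recr/=.
  have := V_decrease n.
  have : curv_min i * ((i \in J n.+1)%:R * sqn (z n i - x n i))
         <= \sum_(i in J n.+1) curv_min i * sqn (z n i - x n i).
    have pos j : 0 <= curv_min j * sqn (z n j - x n j).
      by rewrite mulr_ge0 ?sqn_ge0// ltW// curv_min_gt0.
    have [iJ|iJ] := boolP (i \in J n.+1); last by rewrite mul0r mulr0 sumr_ge0.
    by rewrite mul1r (bigD1 i)//= lerDl sumr_ge0.
  lra.
rewrite -mulr_sumr; have /andP[] := V_ge n; lra.
Qed.

(** * Limits and cluster points on a path with summable residuals *)

Hypothesis summable : cvgn (series (fun k => dist2B (x k) (z k))).

Lemma dist2B_cvg0 : (fun k => dist2B (x k) (z k)) @ \oo --> 0.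
Proof. exact: cvg_series_cvg_0. Qed.

Lemma distB_cvg0 : (fun k => distB (x k) (z k)) @ \oo --> 0.
Proof.
rewrite -(@sqrtr0 R); apply: continuous_cvg dist2B_cvg0.
exact: sqrt_continuous.
Qed.

Let Ps : R := limn V.

Lemma V_nincr : nonincreasing_seq V.
Proof.
apply/nonincreasing_seqP => k; have := V_decrease k.
have : 0 <= \sum_(i in J k.+1) curv_min i * sqn (z k i - x k i).
  by apply: sumr_ge0 => i _; rewrite mulr_ge0 ?sqn_ge0// ltW// curv_min_gt0.
lra.
Qed.

Lemma V_cvg : V @ \oo --> Ps.
Proof.
apply: nonincreasing_is_cvgn; first exact: V_nincr.
by exists m => _ [k _ <-]; have /andP[] := V_ge k; exact: le_trans.
Qed.

Lemma Ps_le_V k : Ps <= V k.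
Proof. by apply: nonincreasing_cvgn_ge V_nincr _ k; exact: cvgP V_cvg. Qed.

(** The curvature bounds squeeze [Phi (z k)] between [V k - K |x k - z k|^2] and [V k]. *)
Lemma Phi_z_cvg : (fun k => FF f (z k) + fine (G (z k))) @ \oo --> Ps.
Proof.
set K := \sum_(i < N) curv_max i.
apply: (@squeeze_cvgr _ _ _ _ (fun k => V k - K * dist2B (x k) (z k)) V).
- near=> k; have /andP[_ ->] := V_ge k; rewrite andbT V_eq.
  have := fb_quad_le (x k) (z k); rewrite -/K; lra.
- rewrite -[X in _ --> X](subr0 Ps) -(mulr0 K).
  by apply: cvgB V_cvg _; apply: cvgMr dist2B_cvg0.
- exact: V_cvg.
Unshelve. all: by end_near. Qed.

(** For each competitor [v], [Ps <= V k <= fb_quad (x k) v + G v]; upper semicontinuity in the base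
    point carries this to [y]. *)
Lemma cluster_le_PhiFB y : cluster_point x y -> (Ps%:E <= PhiFB f G gamma y)%E.
Proof.
move=> cy; apply: le_ereal_inf_tmp => _ [v _ <-]; rewrite FBmodelE.
case Gv : (G v) => [r| |]; last by have := G_proper.1 v; rewrite Gv.
  2: by rewrite addey// leey.
rewrite -EFinD lee_fin; apply/ler_addgt0Pr => e e0.
have [r' r'0 rP] := fb_quad_usc y v e0.
have [k _ /rP q_lt] := cy _ r'0 0.
have : V k <= fb_quad (x k) v + r.
  rewrite -lee_fin -PhiFB_trajectory EFinD -Gv.
  by apply: ereal_inf_lbound; exists v.
have := Ps_le_V k; lra.
Qed.

Lemma cluster_Phi_le y : cluster_point z y -> (Phi f G y <= Ps%:E)%E.
Proof.
move=> cy; rewrite leNgt; apply/negP => Ps_lt.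
(* A real threshold strictly below [G y]: half the gap when [G y] is finite, any positive [e] when
   it is infinite. *)
have [e e0 He] : exists2 e : R, 0 < e & ((Ps - FF f y + e)%:E < G y)%E.
  move: (G_proper.1 y) Ps_lt; rewrite /Phi.
  case: (G y) => [r _|_ _|//]; last by exists 1 => //; exact: ltry.
  rewrite -EFinD lte_fin => h; exists (2^-1 * (FF f y + r - Ps)); first by lra.
  by rewrite lte_fin; lra.
have e20 : 0 < e / 2 by rewrite divr_gt0.
have [r1 r10 r1P] := G_lsc He.
have [r2 r20 r2P] := FF_lsc y e20.
have [k1 _ k1P] : \forall k \near \oo, V k < Ps + e / 2.
  by apply: (cvgr_lt _ V_cvg); rewrite ltrDl.
have r0 : 0 < Num.min r1 r2 by rewrite lt_min r10.
have [k k1k] := cy _ r0 k1; rewrite lt_min => /andP[/r1P Gz /r2P Fz].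
move: Gz; rewrite -[G (z k)]fineK ?(Tmap_fin_num (zT k))// lte_fin => Gz.
(* Here [F + G] at [z k] exceeds [Ps + e/2], although it is at most [V k < Ps + e/2]. *)
have /= := k1P k k1k; have /andP[_] := V_ge k; lra.
Qed.

Lemma trajectory_limit :
  cvgn (series (fun k => dist2B (x k) (z k))) /\
  (fun k => distB (x k) (z k)) @ \oo --> 0 /\
  exists Ps : R,
    (fun k => PhiFB f G gamma (x k)) @ \oo --> Ps%:E /\
    (ereal_inf (range (Phi f G)) <= Ps%:E)%E /\
    (fun k => Phi f G (z k)) @ \oo --> Ps%:E /\
    (forall y, cluster_point x y <-> cluster_point z y) /\
    (forall y, cluster_point x y ->
       frechet_subgrad (Phi f G) y (zeroB R ns) /\
       Phi f G y = PhiFB f G gamma y /\ Phi f G y = Ps%:E).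
Proof.
have zx : (fun k => dist2B (z k) (x k)) @ \oo --> 0.
  have -> : (fun k => dist2B (z k) (x k)) = (fun k => dist2B (x k) (z k)).
    by apply/funext => k; apply: eq_bigr => i _; exact: sqnBC.
  exact: dist2B_cvg0.
split=> //; split; first exact: distB_cvg0.
exists Ps; split; [|split; [|split; [|split]]].
- under eq_fun do rewrite PhiFB_trajectory.
  by apply: cvg_EFin; [near=> k|exact: V_cvg].
- have -> : ereal_inf (range (Phi f G)) = Phi f G xs.
    apply/eqP; rewrite eq_le; apply/andP; split.
      by apply: ereal_inf_lbound; exists xs.
    by apply: le_ereal_inf_tmp => _ [y _ <-].
  rewrite min_Phi_fin lee_fin; apply: limr_ge; first exact: cvgP V_cvg.
  by near=> k; have /andP[] := V_ge k; exact: le_trans.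
- under eq_fun do rewrite (Phi_Tmap (zT _)).
  by apply: cvg_EFin; [near=> k|exact: Phi_z_cvg].
- by move=> y; split; apply: cluster_point_close => //; exact: dist2B_cvg0.
- move=> y cx; have cz := cluster_point_close dist2B_cvg0 cx.
  (* The cycle [Phi y <= Ps <= PhiFB y <= Phi y] forces equality throughout. *)
  have yPs : Phi f G y = Ps%:E.
    apply/eqP; rewrite eq_le cluster_Phi_le//=.
    exact: le_trans (cluster_le_PhiFB cx) (PhiFB_le_Phi y).
  have yFB : Phi f G y = PhiFB f G gamma y.
    by apply/eqP; rewrite eq_le PhiFB_le_Phi andbT yPs cluster_le_PhiFB.
  by split=> //; apply: frechet_stationary yFB; rewrite yPs.
Unshelve. all: by end_near. Qed.

End Trajectory.
End BlockModel.

(** * The sampling inequality, from events to nonnegative functions *)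

Section ConditionalSampling.
Set Implicit Arguments. Unset Strict Implicit.
Variables (R : realType) (d : measure_display) (T : measurableType d).
Variable P : probability T R.

(** Stands in for conditional expectation: [phi] will be the identity of [T] into [T] with the
    sigma-algebra of the past, so that [h] is a past-measurable function. *)
Lemma ge0_le_integral_sampling d' (T' : measurableType d') (phi : T -> T')
    (B : set T) (c : R) (h : T' -> R) :
  measurable_fun setT phi -> measurable B -> 0 <= c ->
  (forall A, measurable A ->
     (c%:E * P (phi @^-1` A) <= P (phi @^-1` A `&` B))%E) ->
  (forall w, 0 <= h w) -> measurable_fun setT h ->
  (c%:E * \int[P]_w (h (phi w))%:E <= \int[P]_(w in B) (h (phi w))%:E)%E.
Proof.
move=> mphi mB c0 cP h0 mh.
(* Both sides are integrals of h against pushforward measures ordered by cP. *)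
have mhE : measurable_fun setT (EFin \o h) by exact/measurable_EFinP.
have mhphi : measurable_fun setT (EFin \o (h \o phi)).
  exact: measurableT_comp mhE mphi.
have hE0 w : (0 <= (h w)%:E)%E by rewrite lee_fin.
pose PB : {measure set T -> \bar R} := mrestr P mB.
pose push (m : {measure set T -> \bar R}) :=
  measure_function_pushforward__canonical__measure_function_Measure m mphi.
pose m1 : {measure set T' -> \bar R} := mscale (NngNum c0) (push P).
pose m2 := push PB.
have m12 A : measurable A -> (m1 A <= m2 A)%E by exact: cP.
have := @ge0_le_measure_integral _ T' R m1 m2 m12 _ _ measurableT hE0 mhE.
rewrite ge0_integral_mscale//.
rewrite !ge0_integral_pushforward// !preimage_setT => /le_trans; apply.
(* The restriction of [P] to [B] does not charge the complement of [B], and on [B] it is dominated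
   by [P]. *)
rewrite -(setvU B) ge0_integral_setU//=; last 3 first.
- exact: measurableC.
- by rewrite setvU.
- by rewrite disj_set2E setICl.
have mCB : measurable (~` B) by exact: measurableC.
rewrite (@null_set_integral _ _ _ PB (~` B))//=; last 2 first.
- exact: measurable_funTS.
- by rewrite /PB/= /mrestr setICl measure0.
rewrite add0e; apply: ge0_le_measure_integral => // A mA.
by rewrite /PB/= /mrestr le_measure ?inE//; exact: measurableI.
Qed.

End ConditionalSampling.

(** * Almost sure summability from sampled partial sums *)

Section SampledSum.
Set Implicit Arguments. Unset Strict Implicit.
Variables (R : realType) (d : measure_display) (T : measurableType d).
Variable P : probability T R.

(** Sampling gives [c E[a_k] <= E[1_(B k) a_k]], so the expectations of the [a_k] sum to at most
    [C / c]. Exchanging sum and integral, the random series has finite expectation and hence is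
    finite almost surely. *)
Lemma sampled_sum_cvg (F : nat -> set (set T)) (a : nat -> T -> R)
    (B : nat -> set T) (c C : R) :
  filtration F -> 0 < c -> (forall k, measurable (B k)) ->
  (forall k w, 0 <= a k w) ->
  (forall k, measurable_fun (setT : set (g_sigma_algebraType (F k)))
               (a k : g_sigma_algebraType (F k) -> R)) ->
  (forall k A, F k A -> (c%:E * P A <= P (A `&` B k))%E) ->
  (forall w n, \sum_(k < n) \1_(B k) w * a k w <= C) ->
  {ae P, forall w, cvgn (series (a ^~ w))}.
Proof.
move=> [sF [Fm _]] c0 mB a0 ma cP aC.
have mid k : measurable_fun setT (id : T -> g_sigma_algebraType (F k)).
  move=> _ A mA; rewrite setTI preimage_id; apply: (Fm k).
  by rewrite -(sigma_algebra_id (sF k)).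
have maT k : measurable_fun setT (a k).
  by move=> _ U mU; have := mid k measurableT _ (ma k measurableT U mU); rewrite !setTI.
have sample k : (c%:E * \int[P]_w (a k w)%:E <= \int[P]_w (\1_(B k) w * a k w)%:E)%E.
  have cPk A : <<s F k >> A -> (c%:E * P A <= P (A `&` B k))%E.
    by rewrite (sigma_algebra_id (sF k)); exact: cP.
  have := @ge0_le_integral_sampling R d T P _ (g_sigma_algebraType (F k)) id
    (B k) c (a k) (mid k) (mB k) (ltW c0) cPk (a0 k) (ma k).
  move=> /le_trans; apply.
  rewrite [leLHS]integral_mkcond le_eqVlt; apply/orP; left; apply/eqP.
  apply: eq_integral => w _; rewrite patchE indicE.
  by case: (w \in B k); rewrite ?mul1r ?mul0r.
have mBa k : measurable_fun setT (EFin \o (fun w => \1_(B k) w * a k w)).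
  by apply/measurable_EFinP; apply: measurable_funM.
have Ba0 k w : (0 <= (\1_(B k) w * a k w)%:E)%E by rewrite lee_fin mulr_ge0.
have sum_le n : (\sum_(k < n) c%:E * \int[P]_w (a k w)%:E <= C%:E)%E.
  apply: (le_trans (lee_sum _ (fun (k : 'I_n) _ => sample k))).
  rewrite -ge0_integral_sum//; last by move=> k; exact: mBa.
  apply: (@le_trans _ _ (\int[P]_w (cst C%:E w))%E).
    apply: ge0_le_integral => //.
    - by move=> w _; exact: sume_ge0.
    - by apply: emeasurable_sum => k; exact: mBa.
    - by move=> w _; rewrite sumEFin lee_fin; exact: aC.
  by rewrite integral_cst//= probability_setT mule1.
have aE0 k w : (0 <= (a k w)%:E)%E by rewrite lee_fin.
have int_fin : (\int[P]_w (\sum_(k <oo) (a k w)%:E) < +oo)%E.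
  rewrite integral_nneseries//; last by move=> k; exact/measurable_EFinP.
  apply: (@le_lt_trans _ _ (c^-1 * C)%:E); last exact: ltry.
  apply: lime_le; first by apply: is_cvg_nneseries => k _ _; exact: integral_ge0.
  near=> n; rewrite big_mkord EFinM lee_pdivlMl// ge0_sume_distrr//.
  by move=> k _; exact: integral_ge0.
have : P.-integrable setT (fun w => \sum_(k <oo) (a k w)%:E)%E.
  apply/integrableP; split.
    by apply: ge0_emeasurable_sum => // k _; exact/measurable_EFinP.
  under eq_integral do rewrite gee0_abs ?nneseries_ge0//.
  exact: int_fin.
move=> /(integrable_ae measurableT); apply: filterS => w /(_ I) fin.
by apply: nnseries_is_cvg => //; rewrite ltey_eq fin.
Unshelve. all: by end_near. Qed.

End SampledSum.

(** * Almost sure convergence of randomly sampled block-coordinate iterates *)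

Theorem theorem2p6 (R : realType) (N : nat) (ns : 'I_N -> nat)
  (f : forall i : 'I_N, 'rV[R]_(ns i) -> R) (L : 'I_N -> R)
  (G : vecB R ns -> \bar R) (gamma : 'I_N -> R)
  (d : measure_display) (T : measurableType d) (P : probability T R)
  (x0 : vecB R ns) (x z : nat -> T -> vecB R ns) (I : nat -> T -> {set 'I_N})
  (p : 'I_N -> R) (F : nat -> set (set T)) :
  (* setting *)
  (0 < N)%N ->
  (forall i (u : 'rV[R]_(ns i)), differentiable (@f i) u) ->
  (forall i, 0 <= L i) ->
  (forall i (u v : 'rV[R]_(ns i)),
      Num.sqrt (sqn (grad (@f i) u - grad (@f i) v)) <= L i * Num.sqrt (sqn (u - v))) ->
  proper_fun G -> lsc_fun G ->
  (exists xs, forall y, (Phi f G xs <= Phi f G y)%E) ->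
  (forall i, 0 < gamma i /\ gamma i * L i < N%:R) ->
  (* Algorithm BC *)
  (forall w, x 0%N w = x0) ->
  (forall k w, Tmap f G gamma (x k w) (z k w)) ->
  (forall k w i, x k.+1 w i = if i \in I k.+1 w then z k w i else x k w i) ->
  (* randomized sampling requirement: F is a filtration to which the past
     (x^0..x^k, z^0..z^k, I^1..I^k) is adapted, and
     P(i in I^{k+1} | F_k) >= p_i *)
  (forall i, 0 < p i) ->
  filtration F ->
  (forall k j, (j <= k)%N -> vec_meas (F k) (x j) /\ vec_meas (F k) (z j)) ->
  (forall k j, (1 <= j <= k)%N -> set_meas (F k) (I j)) ->
  (forall k i A, F k A ->
     ((p i)%:E * P A <= P (A `&` [set w | i \in I k.+1 w]))%E) ->
  {ae P, forall w,
    cvgn (series (fun k => dist2B (x k w) (z k w))) /\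
    (fun k => distB (x k w) (z k w)) @ \oo --> 0 /\
    exists Ps : R,
      (fun k => PhiFB f G gamma (x k w)) @ \oo --> Ps%:E /\
      (ereal_inf (range (Phi f G)) <= Ps%:E)%E /\
      (fun k => Phi f G (z k w)) @ \oo --> Ps%:E /\
      (forall y, cluster_point (fun k => x k w) y <-> cluster_point (fun k => z k w) y) /\
      (forall y, cluster_point (fun k => x k w) y ->
         frechet_subgrad (Phi f G) y (zeroB R ns) /\
         Phi f G y = PhiFB f G gamma y /\ Phi f G y = Ps%:E)}.
Proof.
move=> N0 df L0 lip Gp Gl [xs xs_min] gL x0E zT xS p0 filt adapt adI samp.
(* Blocks are treated separately, each with its own probability [p i] and the event that [i] is
   selected. *)
have cvg_i i : {ae P, forall w, cvgn (series (fun k => sqn (z k w i - x k w i)))}.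
  apply: (@sampled_sum_cvg R d T P F (fun k w => sqn (z k w i - x k w i))
    (fun k => [set w | i \in I k.+1 w]) (p i)
    ((fine (PhiFB f G gamma x0) - fine (Phi f G xs)) / curv_min L gamma i)) => //.
  (* The selection event belongs to [F k.+1]; the residual below must be measurable for the earlier
     [F k]. *)
  - move=> k; have [_ [Fm _]] := filt; apply: (Fm k.+1).
    exact: (adI k.+1 k.+1 (leqnn _) i).
  - by move=> k w; exact: sqn_ge0.
  - move=> k; have [Fk_x Fk_z] := adapt k k (leqnn k).
    have meas (X : T -> vecB R ns) j : vec_meas (F k) X ->
        measurable_fun (setT : set (g_sigma_algebraType (F k)))
          ((fun w => X w i 0 j) : g_sigma_algebraType (F k) -> R).
      by move=> mX _ U mU; rewrite setTI; apply: sub_sigma_algebra; exact: mX.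
    apply: measurable_sum => j; apply: measurable_funX.
    under eq_fun do rewrite !mxE.
    by apply: measurable_funB; exact: meas.
  - by move=> k A; exact: samp.
  - move=> w n; rewrite -(x0E w).
    have := @selected_sum_le R N ns f L gamma N0 df L0 lip gL G Gp
      (x ^~ w) (z ^~ w) (I ^~ w) xs xs_min (zT ^~ w)
      (fun k i => xS k w i) i n.
    apply: le_trans; apply: ler_sum => k _.
    by rewrite indicE mem_setE.
(* Finitely many almost sure events hold simultaneously; from here the argument is deterministic. *)
have := filter_forall (ae_filter_ringOfSetsType P) cvg_i; apply: filterS => w cvg_w.
apply: (@trajectory_limit R N ns f L gamma N0 df L0 lip gL G Gp Gl
  (x ^~ w) (z ^~ w) (I ^~ w) xs xs_min (zT ^~ w) (fun k i => xS k w i)).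
rewrite (_ : series _ = fun n => \sum_(i < N) series (fun k => sqn (z k w i - x k w i)) n).
  by apply: cvgP; apply: cvg_big => [|i _]; [exact: add_continuous|exact: cvg_w].
apply/funext => n; rewrite /series/= exchange_big/=; apply: eq_bigr => k _.
by apply: eq_bigr => i _; exact: sqnBC.
Qed.
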